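(* Let $\Omega$ be a nonempty set and $C$ a commutative unital $\mathbf{k}$-algebra. The $\Omega$-operated $\mathbf{k}$-algebra $((\mathfrak{T}(\Omega,C),\veebar),\Lambda_\Omega)$ of vertex-edge decorated rooted trees, together with the natural embedding $i_C:C\to\mathfrak{T}(\Omega,C)$, is the free $\Omega$-operated $\mathbf{k}$-algebra over $C$.
   Context: $\mathbf{k}$ is a field of characteristic $0$; all algebras are commutative unital $\mathbf{k}$-algebras. An $\Omega$-operated $\mathbf{k}$-algebra is a $\mathbf{k}$-algebra $V$ with $\mathbf{k}$-linear maps $P_\omega:V\to V$, $\omega\in\Omega$; write $P_\Omega=(P_\omega\mid\omega\in\Omega)$. A homomorphism $(V,P_\Omega)\to(U,Q_\Omega)$ is an algebra homomorphism $f$ with $fP_\omega=Q_\omega f$ for all $\omega$. The free $\Omega$-operated $\mathbf{k}$-algebra over $C$ is an $\Omega$-operated algebra $(F,\Pi_\Omega)$ with an algebra homomorphism $i_C:C\to F$ such that for any $\Omega$-operated algebra $(R,P_\Omega)$ and any algebra homomorphism $f:C\to R$ there is a unique $\Omega$-operated algebra homomorphism $\bar f:(F,\Pi_\Omega)\to(R,P_\Omega)$ with $\bar f\, i_C=f$. Trees. $\mathcal{T}(\Omega,C)$ is the set of nonplanar rooted trees with vertices decorated by elements of $C$ and edges decorated by elements of $\Omega$ (vertex-edge decorated trees). $\mathfrak{T}(\Omega,C)$ is the $\mathbf{k}$-module spanned by $\mathcal{T}(\Omega,C)$, where trees are taken to be $\mathbf{k}$-linear in the decoration of each vertex (i.e.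 the free module on $\mathcal{T}(\Omega,C)$ modulo the relations expressing multilinearity in the vertex decorations). Let $\bullet_c$ denote the one-vertex tree decorated by $c\in C$. The product $T\veebar U$ of two decorated trees is obtained by merging the roots of $T$ and $U$ into one common root, which carries all branches of $T$ and of $U$ and is decorated by the product in $C$ of the decorations of the two roots; $\veebar$ is extended bilinearly. For $\omega\in\Omega$, the linear operator $\Lambda_\omega$ sends a decorated tree $T$ to the tree obtained by adding a new root, decorated by $1\in C$, joined to the root of $T$ by a new edge decorated by $\omega$. $\Lambda_\Omega=(\Lambda_\omega\mid\omega\in\Omega)$. The natural embedding is $i_C(c)=\bullet_c$. *)

(* Defs.v *)
From HB Require Import structures.
From Stdlib Require Import Permutation.
From mathcomp Require Import all_boot all_order all_algebra.
From mathcomp Require Import boolp.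
From mathcomp.multinomials Require Import freeg.

Set Implicit Arguments.
Unset Strict Implicit.
Unset Printing Implicit Defensive.

Import GRing.Theory.
Local Open Scope ring_scope.
Local Open Scope quotient_scope.

(* Commutative unital algebras, the zero algebra included: MathComp's         *)
(* [comAlgType] requires 1 != 0, hence this bundle of a [comPzRingType] with  *)
(* a compatible left module structure.                                        *)
Record comPzAlg (k : fieldType) := ComPzAlg {
  calg_ring : comPzRingType;
  calg_scale : k -> calg_ring -> calg_ring;
  calg_scaleA : forall a b v,
    calg_scale a (calg_scale b v) = calg_scale (a * b) v;
  calg_scale1 : left_id 1 calg_scale;
  calg_scaleDr : right_distributive calg_scale +%R;
  calg_scaleDl : forall v, {morph calg_scale^~ v : a b / a + b};
  calg_scaleAl : forall a x y, calg_scale a (x * y) = calg_scale a x * y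
}.

Definition calg_sort (k : fieldType) (A : comPzAlg k) : Type := calg_ring A.
Coercion calg_sort : comPzAlg >-> Sortclass.

HB.instance Definition _ (k : fieldType) (A : comPzAlg k) :=
  GRing.ComPzRing.copy (calg_sort A) (calg_ring A).
HB.instance Definition _ (k : fieldType) (A : comPzAlg k) :=
  GRing.Zmodule_isLmodule.Build k (calg_sort A)
    (@calg_scaleA k A) (@calg_scale1 k A) (@calg_scaleDr k A)
    (@calg_scaleDl k A).

Lemma calg_scalerAl (k : fieldType) (A : comPzAlg k) (a : k) (x y : A) :
  a *: (x * y) = a *: x * y.
Proof. exact: calg_scaleAl. Qed.

Definition alg_hom (k : fieldType) (A B : comPzAlg k) (f : A -> B) : Prop :=
  linear f /\ monoid_morphism f.

Record operatedAlg (k : fieldType) (Omega : Type) := OperatedAlg {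
  oalg :> comPzAlg k;
  oalg_op : Omega -> oalg -> oalg;
  oalg_op_linear : forall w, linear (oalg_op w)
}.

Definition operated_hom (k : fieldType) (Omega : Type)
    (V U : operatedAlg k Omega) (f : V -> U) : Prop :=
  alg_hom f /\ (forall w, f \o oalg_op w = oalg_op w \o f).

Definition is_free_operatedAlg (k : fieldType) (Omega : Type) (C : comPzAlg k)
    (F : operatedAlg k Omega) (iC : C -> F) : Prop :=
  alg_hom iC /\
  forall (R : operatedAlg k Omega) (f : C -> R), alg_hom f ->
    exists! fbar : F -> R, operated_hom fbar /\ fbar \o iC = f.

(* Planar representatives of decorated trees: a root decoration and the list  *)
(* of branches, each with the decoration of the edge joining it to the root.  *)
Inductive ptree (Omega C : Type) : Type :=
  PNode of C & seq (Omega * ptree Omega C).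

HB.instance Definition _ (Omega C : Type) := gen_eqMixin (ptree Omega C).
HB.instance Definition _ (Omega C : Type) := gen_choiceMixin (ptree Omega C).

(* Equality of the underlying nonplanar trees. Since branches may be          *)
(* permuted, it is enough to rewrite inside the first one.                    *)
Inductive ptree_iso (Omega C : Type) : ptree Omega C -> ptree Omega C -> Prop :=
| iso_refl t : ptree_iso t t
| iso_sym t u : ptree_iso t u -> ptree_iso u t
| iso_trans t u v : ptree_iso t u -> ptree_iso u v -> ptree_iso t v
| iso_perm c s s' : Permutation s s' -> ptree_iso (PNode c s) (PNode c s')
| iso_branch c w t t' s : ptree_iso t t' ->
    ptree_iso (PNode c ((w, t) :: s)) (PNode c ((w, t') :: s)).

Definition ptree_isob (Omega C : Type) (t u : ptree Omega C) : bool :=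
  `[< ptree_iso t u >].

Section PtreeEquiv.
Variables Omega C : Type.

Lemma ptree_isob_refl : reflexive (@ptree_isob Omega C).
Proof. by move=> t; apply/asboolP; exact: iso_refl. Qed.

Lemma ptree_isob_sym : symmetric (@ptree_isob Omega C).
Proof. by move=> t u; apply/asboolP/asboolP; exact: iso_sym. Qed.

Lemma ptree_isob_trans : transitive (@ptree_isob Omega C).
Proof.
by move=> u t v /asboolP tu /asboolP uv; apply/asboolP; exact: iso_trans tu uv.
Qed.

Canonical ptree_equiv :=
  EquivRel (@ptree_isob Omega C) ptree_isob_refl ptree_isob_sym ptree_isob_trans.
Canonical ptree_encModRel := defaultEncModRel (@ptree_isob Omega C).

Definition dtree := {eq_quot (@ptree_isob Omega C)}.
HB.instance Definition _ := Choice.on dtree.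
HB.instance Definition _ := Quotient.on dtree.
HB.instance Definition _ : EqQuotient _ (@ptree_isob Omega C) dtree :=
  EqQuotient.on dtree.

Definition mk_dtree (c : C) (s : seq (Omega * ptree Omega C)) : dtree :=
  \pi_dtree (PNode c s).

Lemma dtreeP (t u : ptree Omega C) :
  \pi_dtree t = \pi_dtree u <-> ptree_iso t u.
Proof. by split=> [/eqmodP/asboolP//|tu]; apply/eqmodP/asboolP. Qed.

Lemma dtree_ind (P : dtree -> Prop) :
  (forall c s, P (mk_dtree c s)) -> forall t, P t.
Proof. by move=> Pt; elim/quotW => -[]. Qed.

End PtreeEquiv.

Section TreeOperations.
Variables (k : fieldType) (Omega : Type) (C : comPzAlg k).
Local Notation ptree := (ptree Omega C).
Local Notation dtree := (dtree Omega C).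

Definition bullet (c : C) : dtree := mk_dtree c [::].

Definition pmerge (t u : ptree) : ptree :=
  let: PNode c s := t in let: PNode d r := u in PNode (c * d) (s ++ r).

Lemma pmerge_isol t t' u : ptree_iso t t' -> ptree_iso (pmerge t u) (pmerge t' u).
Proof.
case: u => d r; elim=> {t t'} [t|t t' _|t t' t'' _ ih1 _|c s s' ss'|c w t t' s tt' _].
- exact: iso_refl.
- exact: iso_sym.
- exact: iso_trans.
- by apply: iso_perm; apply: Permutation_app_tail.
- exact: iso_branch.
Qed.

Lemma pmergeC t u : ptree_iso (pmerge t u) (pmerge u t).
Proof.
case: t => c s; case: u => d r; rewrite /= mulrC.
by apply: iso_perm; apply: Permutation_app_comm.
Qed.

Definition merge (t u : dtree) : dtree := \pi_dtree (pmerge (repr t) (repr u)).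

Definition graft (w : Omega) (t : dtree) : dtree :=
  mk_dtree 1 [:: (w, repr t)].

Lemma mergeE (c d : C) s r :
  merge (mk_dtree c s) (mk_dtree d r) = mk_dtree (c * d) (s ++ r).
Proof.
apply/dtreeP; rewrite -[PNode (_ * _) _]/(pmerge (PNode c s) (PNode d r)).
have repiso (t : ptree) : ptree_iso (repr (\pi_dtree t)) t.
  by apply/dtreeP; rewrite reprK.
apply: iso_trans (pmerge_isol _ (repiso _)) _.
apply: iso_trans (pmergeC _ _) _; apply: iso_trans (pmergeC _ _) => /=.
exact: pmerge_isol (repiso _).
Qed.

Lemma graftE w (t : ptree) : graft w (\pi_dtree t) = mk_dtree 1 [:: (w, t)].
Proof. by apply/dtreeP/iso_branch/dtreeP; rewrite reprK. Qed.

Lemma mergeA : associative merge.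
Proof.
elim/dtree_ind=> c s; elim/dtree_ind=> d r; elim/dtree_ind=> e q.
by rewrite !mergeE mulrA catA.
Qed.

Lemma mergeC : commutative merge.
Proof.
elim/dtree_ind=> c s; elim/dtree_ind=> d r; rewrite !mergeE mulrC.
by apply/dtreeP; apply: iso_perm; apply: Permutation_app_comm.
Qed.

Lemma merge1t : left_id (bullet 1) merge.
Proof. by elim/dtree_ind=> c s; rewrite mergeE mul1r. Qed.

(* A tree with one vertex left undecorated; branches being unordered, the     *)
(* path from the root to that vertex may always follow first branches.        *)
Inductive vertexctx : Type :=
| VRoot of seq (Omega * ptree)
| VBranch of C & Omega & vertexctx & seq (Omega * ptree).

Fixpoint decorate (K : vertexctx) (c : C) : ptree :=
  match K with
  | VRoot s => PNode c s
  | VBranch d w K' s => PNode d ((w, decorate K' c) :: s)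
  end.

Local Notation formal := {freeg dtree / k}.

Inductive multilin : formal -> Prop :=
| multilin_gen K a c d :
    multilin (<< \pi_dtree (decorate K (a *: c + d)) >>
              - (a *: << \pi_dtree (decorate K c) >> + << \pi_dtree (decorate K d) >>))
| multilin0 : multilin 0
| multilin_lin a x y : multilin x -> multilin y -> multilin (a *: x + y).

Lemma multilinN x : multilin x -> multilin (- x).
Proof.
move=> mx; rewrite -[- x]addr0 -scaleN1r.
exact: multilin_lin mx multilin0.
Qed.

Lemma multilinD x y : multilin x -> multilin y -> multilin (x + y).
Proof. by move=> mx my; rewrite -[x]scale1r; exact: multilin_lin. Qed.

Definition multilin_eq (x y : formal) : bool := `[< multilin (x - y) >].

Lemma multilin_eq_refl : reflexive multilin_eq.
Proof. by move=> x; apply/asboolP; rewrite subrr; exact: multilin0. Qed.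

Lemma multilin_eq_sym : symmetric multilin_eq.
Proof.
by move=> x y; apply/asboolP/asboolP=> /multilinN; rewrite opprB.
Qed.

Lemma multilin_eq_trans : transitive multilin_eq.
Proof.
move=> y x z /asboolP xy /asboolP yz; apply/asboolP.
by have := multilinD xy yz; rewrite addrA subrK.
Qed.

Canonical multilin_equiv :=
  EquivRel multilin_eq multilin_eq_refl multilin_eq_sym multilin_eq_trans.
Canonical multilin_encModRel := defaultEncModRel multilin_eq.

Definition treemod := {eq_quot multilin_eq}.
HB.instance Definition _ := Choice.on treemod.
HB.instance Definition _ := Quotient.on treemod.
HB.instance Definition _ : EqQuotient _ multilin_eq treemod :=
  EqQuotient.on treemod.

Local Notation cls := (fun x : formal => \pi_treemod x).

Lemma clsP (x y : formal) : cls x = cls y <-> multilin (x - y).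
Proof. by split=> [/eqmodP/asboolP//|xy]; apply/eqmodP/asboolP. Qed.

Lemma repr_cls (x : formal) : multilin (repr (cls x) - x).
Proof. by apply/clsP; rewrite reprK. Qed.

Lemma treemod_ind (P : treemod -> Prop) :
  (forall x, P (cls x)) -> forall X, P X.
Proof. by move=> Px; elim/quotW. Qed.

Definition treeclass (t : dtree) : treemod := \pi_treemod (<< t >> : formal).

Definition tadd (X Y : treemod) : treemod := \pi_treemod (repr X + repr Y).
Definition topp (X : treemod) : treemod := \pi_treemod (- repr X).
Definition tscale (a : k) (X : treemod) : treemod := \pi_treemod (a *: repr X).

Lemma taddE x y : tadd (cls x) (cls y) = cls (x + y).
Proof.
apply/clsP; rewrite opprD addrACA.
exact: multilinD (repr_cls _) (repr_cls _).
Qed.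

Lemma toppE x : topp (cls x) = cls (- x).
Proof. by apply/clsP; rewrite -opprD; apply/multilinN/repr_cls. Qed.

Lemma tscaleE a x : tscale a (cls x) = cls (a *: x).
Proof.
apply/clsP; rewrite -scalerBr -[_ *: _]addr0.
exact: multilin_lin (repr_cls _) multilin0.
Qed.

Lemma taddA : associative tadd.
Proof.
elim/treemod_ind=> x; elim/treemod_ind=> y; elim/treemod_ind=> z.
by rewrite !taddE addrA.
Qed.
Lemma taddC : commutative tadd.
Proof. by elim/treemod_ind=> x; elim/treemod_ind=> y; rewrite !taddE addrC. Qed.
Lemma tadd0 : left_id (cls 0) tadd.
Proof. by elim/treemod_ind=> x; rewrite taddE add0r. Qed.
Lemma taddN : left_inverse (cls 0) topp tadd.
Proof. by elim/treemod_ind=> x; rewrite toppE taddE addNr. Qed.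

HB.instance Definition _ :=
  GRing.isZmodule.Build treemod taddA taddC tadd0 taddN.

Lemma tscaleA a b X : tscale a (tscale b X) = tscale (a * b) X.
Proof. by elim/treemod_ind: X => x; rewrite !tscaleE scalerA. Qed.
Lemma tscale1 : left_id 1 tscale.
Proof. by elim/treemod_ind=> x; rewrite tscaleE scale1r. Qed.
Lemma tscaleDr : right_distributive tscale +%R.
Proof.
move=> a; elim/treemod_ind=> x; elim/treemod_ind=> y.
by rewrite [_ + _]taddE !tscaleE [RHS]taddE scalerDr.
Qed.
Lemma tscaleDl X : {morph tscale^~ X : a b / a + b}.
Proof.
by move=> a b; elim/treemod_ind: X => x; rewrite !tscaleE [RHS]taddE scalerDl.
Qed.

HB.instance Definition _ :=
  GRing.Zmodule_isLmodule.Build k treemod tscaleA tscale1 tscaleDr tscaleDl.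

Lemma freeg_lin_ind (P : formal -> Prop) :
  P 0 -> (forall a t x, P x -> P (a *: << t >> + x)) -> forall x, P x.
Proof.
move=> P0 PS; elim/freeg_ind_dom0=> // a t x _ _ Px.
have -> : << a *g t >> = a *: << t >> :> formal.
  by apply/eqP/freeg_eqP=> u; rewrite coeffZ !coeffU mul1r.
exact: PS.
Qed.

HB.instance Definition _ (V : lmodType k) (f : dtree -> V) :=
  GRing.isZmodMorphism.Build formal V (fglift f) (lift_is_additive f).

Lemma fglift_linear (V : lmodType k) (f : dtree -> V) :
  linear (fglift f : formal -> V).
Proof.
move=> a x y; rewrite raddfD /=; congr (_ + _).
elim/freeg_lin_ind: x => [|b t x ihx]; first by rewrite scaler0 raddf0 scaler0.
rewrite scalerDr (raddfD (fglift f)) [fglift f (_ + x)]raddfD /= ihx scalerDr; congr (_ + _).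
have zU c : c *: << t >> = << c *g t >> :> formal.
  by apply/eqP/freeg_eqP=> u; rewrite coeffZ !coeffU mul1r.
by rewrite scalerA !zU !liftU scalerA.
Qed.

Lemma fgliftU (V : lmodType k) (f : dtree -> V) t :
  fglift f (<< t >> : formal) = f t.
Proof. by rewrite liftU scale1r. Qed.

Definition fmul (x y : formal) : formal :=
  fglift (fun t => fglift (fun u => << merge t u >>) y) x.

Definition fgraft (w : Omega) : formal -> formal :=
  fglift (fun t => << graft w t >>).

Lemma fmulU t u : fmul << t >> << u >> = << merge t u >>.
Proof. by rewrite /fmul !fgliftU. Qed.

Lemma fmul_linl a x y z : fmul (a *: x + y) z = a *: fmul x z + fmul y z.
Proof. exact: fglift_linear. Qed.

Lemma fmul0l y : fmul 0 y = 0.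
Proof. by rewrite /fmul raddf0. Qed.

Lemma fmulUr t x : fmul x << t >> = fmul << t >> x.
Proof.
rewrite {2}/fmul fgliftU; elim/freeg_lin_ind: x => [|a u x ihx].
  by rewrite fmul0l raddf0.
by rewrite fmul_linl ihx fglift_linear fgliftU fmulU mergeC.
Qed.

Lemma fmulUlin t a y z :
  fmul << t >> (a *: y + z) = a *: fmul << t >> y + fmul << t >> z.
Proof. by rewrite -!fmulUr fmul_linl. Qed.

Lemma fmul_linr a x y z : fmul z (a *: x + y) = a *: fmul z x + fmul z y.
Proof.
elim/freeg_lin_ind: z => [|b t z ihz]; first by rewrite !fmul0l scaler0 addr0.
rewrite !fmul_linl fmulUlin ihz !scalerDr !scalerA mulrC.
by rewrite addrACA.
Qed.

Lemma fmul0r x : fmul x 0 = 0.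
Proof.
have := fmul_linr (-1) 0 0 x.
by rewrite !scaleN1r oppr0 addr0 addNr.
Qed.

Lemma fmulC : commutative fmul.
Proof.
move=> x; elim/freeg_lin_ind=> [|a t y ihy]; first by rewrite fmul0l fmul0r.
by rewrite fmul_linr fmul_linl ihy fmulUr.
Qed.

Lemma fmulA : associative fmul.
Proof.
elim/freeg_lin_ind=> [y z|a t x ihx y z]; first by rewrite !fmul0l.
rewrite !fmul_linl ihx; congr (_ *: _ + _).
elim/freeg_lin_ind: y z => [|b u y ihy] z; first by rewrite ?(fmul0l, fmul0r).
rewrite fmul_linl fmulUlin ihy fmulUlin fmul_linl; congr (_ *: _ + _).
elim/freeg_lin_ind: z => [|c v z ihz]; first by rewrite ?(fmul0l, fmul0r).
by rewrite !fmul_linr ihz !fmulU mergeA.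
Qed.

Lemma fmul1l : left_id << bullet 1 >> fmul.
Proof.
elim/freeg_lin_ind=> [|a t x ihx]; first by rewrite fmul0r.
by rewrite fmul_linr fmulU merge1t ihx.
Qed.

Lemma fmul_multilinl x y : multilin x -> multilin (fmul x y).
Proof.
elim=> {x} [K a c d||a x z _ mx _ mz]; last 1 first.
- by rewrite fmul_linl; exact: multilin_lin.
- elim/freeg_lin_ind: y => [|b t y ihy]; first by rewrite fmul0r; exact: multilin0.
  rewrite fmul_linr; apply: multilin_lin ihy.
  have mU x y' z : fmul (x - (a *: y' + z)) << t >> =
      fmul x << t >> - (a *: fmul y' << t >> + fmul z << t >>).
    by rewrite addrC -scaleN1r fmul_linl fmul_linl scaleN1r addrC.
  rewrite mU !fmulU; elim/dtree_ind: t {mU} => e r.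
  have [K' [e' kK]] : exists K' e',
      forall x, merge (\pi_dtree (decorate K x)) (mk_dtree e r) =
                \pi_dtree (decorate K' (x * e')).
    case: K => [s|f w K s]; last first.
      exists (VBranch (f * e) w K (s ++ r)), 1 => x.
      by rewrite [LHS]mergeE mulr1.
    by exists (VRoot (s ++ r)), e => x; rewrite [LHS]mergeE.
  by rewrite !kK mulrDl -calg_scalerAl; exact: multilin_gen.
- by rewrite fmul0l; exact: multilin0.
Qed.

Lemma fgraft_multilin w x : multilin x -> multilin (fgraft w x).
Proof.
rewrite /fgraft; elim=> {x} [K a c d||a x z _ mx _ mz]; last 1 first.
- by rewrite fglift_linear; exact: multilin_lin.
- rewrite raddfB /= fglift_linear !fgliftU !graftE.
  exact: (multilin_gen (VBranch 1 w K [::])).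
- by rewrite raddf0; exact: multilin0.
Qed.

Definition tmul (X Y : treemod) : treemod := \pi_treemod (fmul (repr X) (repr Y)).

Lemma tmulE x y : tmul (cls x) (cls y) = cls (fmul x y).
Proof.
have cl u v z : multilin (u - v) -> multilin (fmul u z - fmul v z).
  move=> /(fmul_multilinl z); rewrite addrC -scaleN1r fmul_linl scaleN1r.
  by rewrite addrC.
apply/clsP; set x' := repr (cls x); set y' := repr (cls y).
rewrite -[fmul x' y'](subrK (fmul x y')) -addrA.
apply: multilinD; first exact/cl/repr_cls.
by rewrite ![fmul x _]fmulC; exact/cl/repr_cls.
Qed.

Lemma tmulA : associative tmul.
Proof.
elim/treemod_ind=> x; elim/treemod_ind=> y; elim/treemod_ind=> z.
by rewrite !tmulE fmulA.
Qed.
Lemma tmulC : commutative tmul.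
Proof. by elim/treemod_ind=> x; elim/treemod_ind=> y; rewrite !tmulE fmulC. Qed.
Lemma tmul1 : left_id (treeclass (bullet 1)) tmul.
Proof. by elim/treemod_ind=> x; rewrite tmulE fmul1l. Qed.
Lemma tmulDl : left_distributive tmul +%R.
Proof.
elim/treemod_ind=> x; elim/treemod_ind=> y; elim/treemod_ind=> z.
rewrite [_ + _]taddE !tmulE [RHS]taddE.
by rewrite -[x]scale1r fmul_linl !scale1r.
Qed.

HB.instance Definition _ :=
  GRing.Zmodule_isComPzRing.Build treemod tmulA tmulC tmul1 tmulDl.

Lemma tscaleAl a (X Y : treemod) : a *: (X * Y) = a *: X * Y.
Proof.
elim/treemod_ind: X => x; elim/treemod_ind: Y => y.
rewrite [_ * _]tmulE [LHS]tscaleE [a *: _]tscaleE [RHS]tmulE.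
by rewrite -[a *: x]addr0 fmul_linl fmul0l addr0.
Qed.

Definition treealg : comPzAlg k :=
  @ComPzAlg k treemod *:%R (@scalerA _ _) (@scale1r _ _) (@scalerDr _ _)
    (fun v a b => scalerDl v a b) tscaleAl.

Definition Lambda (w : Omega) (X : treealg) : treealg :=
  \pi_treemod (fgraft w (repr (X : treemod))).

Lemma LambdaE w x : Lambda w (cls x) = cls (fgraft w x).
Proof.
apply/clsP; rewrite -raddfB /=; exact/fgraft_multilin/repr_cls.
Qed.

Lemma Lambda_linear w : linear (Lambda w).
Proof.
move=> a; elim/treemod_ind=> x; elim/treemod_ind=> y.
rewrite [a *: _]tscaleE [_ + _]taddE !LambdaE [a *: _]tscaleE [RHS]taddE.
by rewrite /fgraft fglift_linear.
Qed.

Definition tree_operatedAlg : operatedAlg k Omega :=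
  @OperatedAlg k Omega treealg Lambda Lambda_linear.

Definition tree_embed (c : C) : tree_operatedAlg := treeclass (bullet c).

Lemma treeclassM t u :
  (treeclass t : treealg) * treeclass u = treeclass (merge t u).
Proof. by rewrite [LHS]tmulE fmulU. Qed.

Lemma Lambda_treeclass w t : Lambda w (treeclass t) = treeclass (graft w t).
Proof. by rewrite LambdaE /fgraft fgliftU. Qed.

End TreeOperations.

(* Main.v *)
Require Import Defs.
From Stdlib Require Import Permutation.
From mathcomp Require Import all_boot all_order all_algebra.
From mathcomp Require Import boolp.
From mathcomp.multinomials Require Import freeg.

(** Freeness holds because a decorated tree is nothing but a way of writing a
    product: every tree arises from one-vertex trees by repeatedly merging with
    a grafted tree, [PNode c ((w, t) :: s)] being the merge of [graft w t] with
    [PNode c s] ([dtree_graft_ind]).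

    Uniqueness follows at once: an operated homomorphism is determined on trees
    by its values on one-vertex trees, and on the whole module because the
    classes of trees span it ([operated_hom_ext]).

    For existence, an algebra homomorphism [f] from [C] into an operated algebra
    [R] prescribes the value of a tree: replace each decoration by its image
    under [f], each edge by the operator it names, and multiply at each vertex
    ([eval]). Three facts turn this recursion into a map on the tree algebra.
    Commutativity of [R] makes the value independent of the order of branches
    ([eval_iso]); linearity of [f] and of the operators makes it linear in each
    vertex decoration ([eval_decorate]), so the linear extension kills the
    multilinearity relations ([flift_multilin]); and multiplicativity of [f]
    gives compatibility with merging ([deval_merge]), while [f 1 = 1] gives
    compatibility with grafting ([deval_graft]). *)

Set Implicit Arguments.
Unset Strict Implicit.
Unset Printing Implicit Defensive.

Import GRing.Theory.
Local Open Scope ring_scope.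
Local Open Scope quotient_scope.

Lemma calg_scalerAr (k : fieldType) (A : comPzAlg k) (a : k) (x y : A) :
  a *: (x * y) = x * (a *: y).
Proof. by rewrite mulrC calg_scalerAl mulrC. Qed.

(** The induction principle generated for the nested type [ptree] gives no
    hypothesis on branches. This one peels off the branches of the root one at
    a time, which matches the generation of trees by merging and grafting. *)
Lemma ptree_branch_ind (Omega C : Type) (Q : ptree Omega C -> Prop) :
    (forall c, Q (PNode c [::])) ->
    (forall c w t s, Q t -> Q (PNode c s) -> Q (PNode c ((w, t) :: s))) ->
  forall t, Q t.
Proof.
move=> Q0 QS; fix IH 1 => -[c s].
elim: s => [|[w t] s IHs]; first exact: Q0.
exact: QS (IH t) IHs.
Qed.

Lemma dtree_graft_ind (k : fieldType) (Omega : Type) (C : comPzAlg k)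
    (Q : dtree Omega C -> Prop) :
    (forall c, Q (bullet Omega c)) ->
    (forall w t u, Q t -> Q u -> Q (Defs.merge (graft w t) u)) ->
  forall t, Q t.
Proof.
move=> Q0 QS; elim/quotW; elim/ptree_branch_ind=> [c|c w t s Qt Qs]; first exact: Q0.
by have := QS w _ _ Qt Qs; rewrite graftE mergeE mul1r.
Qed.

Section TreeAlgebra.
Variables (k : fieldType) (Omega : Type) (C : comPzAlg k).
Local Notation formal := {freeg (dtree Omega C) / k}.
Local Notation cls := (fun x : formal => \pi_(treemod Omega C) x).

(** Multilinearity at the vertex of a one-vertex tree is linearity of the
    embedding; the embedding is multiplicative since merging multiplies root
    decorations. *)
Lemma tree_embed_alg_hom : alg_hom (@tree_embed k Omega C).
Proof.
split=> [a c d|].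
  transitivity (cls (a *: << bullet Omega c >> + << bullet Omega d >>)).
    apply/clsP; exact: (multilin_gen (VRoot [::]) a c d).
  by rewrite -taddE -tscaleE.
by split=> // c d; rewrite [RHS]treeclassM mergeE.
Qed.

Lemma treemod_lin_ind (Q : treemod Omega C -> Prop) :
    Q 0 -> (forall a t X, Q X -> Q (a *: treeclass t + X)) ->
  forall X, Q X.
Proof.
move=> Q0 QS; elim/treemod_ind; elim/freeg_lin_ind=> [//|a t x Qx].
by have := QS a t _ Qx; rewrite [_ *: _]tscaleE [_ + _]taddE.
Qed.

Lemma operated_hom_ext (R : operatedAlg k Omega)
    (g h : tree_operatedAlg Omega C -> R) :
    operated_hom g -> operated_hom h ->
    g \o @tree_embed k Omega C = h \o @tree_embed k Omega C ->
  g = h.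
Proof.
move=> [[glin [_ gM]] gP] [[hlin [_ hM]] hP] gh.
have lin0 (e : tree_operatedAlg Omega C -> R) : linear e -> e 0 = 0.
  by move=> elin; have := elin (-1) 0 0; rewrite !scaleN1r !addNr.
apply/funext; elim/treemod_lin_ind=> [|a t X ghX].
  by rewrite [LHS]lin0 // [RHS]lin0.
rewrite [LHS]glin [RHS]hlin ghX; congr (_ *: _ + _).
elim/dtree_graft_ind: t {X ghX} => [c|w t u ght ghu]; first exact: (congr1 (@^~ c) gh).
rewrite -treeclassM -Lambda_treeclass [LHS]gM [RHS]hM ghu; congr (_ * _).
have := congr1 (@^~ (treeclass t)) (gP w); have := congr1 (@^~ (treeclass t)) (hP w).
by move=> /= -> ->; rewrite ght.
Qed.

End TreeAlgebra.

Section Evaluation.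
Variables (k : fieldType) (Omega : Type) (C : comPzAlg k).
Variables (R : operatedAlg k Omega) (f : C -> R).
Local Notation ptree := (ptree Omega C).
Local Notation dtree := (dtree Omega C).
Local Notation formal := {freeg dtree / k}.
Local Notation cls := (fun x : formal => \pi_(treemod Omega C) x).

(** The product over the branches is spelled as a [foldr], which unfolds as the
    guard condition requires, whereas the iterated product is locked; [evalE]
    restores the product. *)
Fixpoint eval (t : ptree) : R :=
  let: PNode c s := t in
  f c * foldr (fun b x => oalg_op b.1 (eval b.2) * x) 1 s.

Definition eval_branches (s : seq (Omega * ptree)) : R :=
  \prod_(b <- s) oalg_op b.1 (eval b.2).

Lemma evalE c s : eval (PNode c s) = f c * eval_branches s.
Proof. by rewrite /eval_branches unlock. Qed.

Lemma eval_branches_cons w t s :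
  eval_branches ((w, t) :: s) = oalg_op w (eval t) * eval_branches s.
Proof. exact: big_cons. Qed.

Lemma eval_branches_perm s s' :
  Permutation s s' -> eval_branches s = eval_branches s'.
Proof.
elim=> {s s'} [//|[w t] s s' _ IH|[w t] [w' t'] s|s s' s'' _ -> _ //].
  by rewrite !eval_branches_cons IH.
by rewrite !eval_branches_cons mulrCA.
Qed.

Lemma eval_iso t u : ptree_iso t u -> eval t = eval u.
Proof.
elim=> {t u} [//|//|t u v _ -> _ //|c s s' ss'|c w t t' s _ IH].
  by rewrite !evalE (eval_branches_perm ss').
by rewrite !evalE !eval_branches_cons IH.
Qed.

Definition deval (t : dtree) : R := eval (repr t).

Lemma devalE t : deval (\pi_dtree t) = eval t.
Proof. by apply/eval_iso/dtreeP; rewrite reprK. Qed.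

Definition flift : formal -> R := fglift deval.

Lemma flift_linear : linear flift.
Proof. exact: fglift_linear. Qed.

Lemma fliftU t : flift << t >> = deval t.
Proof. exact: fgliftU. Qed.

Lemma flift0 : flift 0 = 0.
Proof. exact: raddf0. Qed.

Hypothesis f_hom : alg_hom f.

Lemma deval_merge t u : deval (Defs.merge t u) = deval t * deval u.
Proof.
have [_ [_ fM]] := f_hom.
elim/dtree_ind: t => c s; elim/dtree_ind: u => d r.
rewrite mergeE !devalE !evalE [f _]fM mulrACA; congr (_ * _).
exact: big_cat.
Qed.

Lemma deval_graft w t : deval (graft w t) = oalg_op w (deval t).
Proof.
have [_ [f1 _]] := f_hom.
by rewrite devalE evalE f1 mul1r /eval_branches big_seq1.
Qed.

Lemma deval_bullet c : deval (bullet Omega c) = f c.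
Proof. by rewrite devalE evalE /eval_branches big_nil mulr1. Qed.

(** At the distinguished vertex this is linearity of [f]; on the way up to the
    root, linearity is preserved by each operator and by multiplication with
    the values of the other branches. *)
Lemma eval_decorate (K : vertexctx Omega C) a c d :
  eval (decorate K (a *: c + d)) =
  a *: eval (decorate K c) + eval (decorate K d).
Proof.
have [flin _] := f_hom.
elim: K => [s|e w K IH s] /=.
  by rewrite flin mulrDl calg_scalerAl.
rewrite IH oalg_op_linear mulrDl mulrDr; congr (_ + _).
by rewrite -calg_scalerAl [RHS]calg_scalerAr.
Qed.

Lemma flift_multilin x : multilin x -> flift x = 0.
Proof.
elim=> {x} [K a c d||a x y _ fx _ fy]; last by rewrite flift_linear fx fy scaler0 addr0.
  rewrite addrC -scaleN1r !flift_linear !fliftU !devalE eval_decorate.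
  by rewrite scaleN1r addNr.
exact: flift0.
Qed.

Lemma flift_fmul x y : flift (fmul x y) = flift x * flift y.
Proof.
elim/freeg_lin_ind: x => [|a t x IHx]; first by rewrite fmul0l flift0 mul0r.
rewrite fmul_linl !flift_linear IHx mulrDl -calg_scalerAl; congr (_ *: _ + _).
elim/freeg_lin_ind: y {x IHx} => [|b u y IHy]; first by rewrite fmul0r flift0 mulr0.
rewrite fmul_linr !flift_linear IHy fmulU !fliftU deval_merge mulrDr.
by rewrite calg_scalerAr.
Qed.

Lemma flift_fgraft w x : flift (fgraft w x) = oalg_op w (flift x).
Proof.
have op0 : oalg_op w 0 = 0 :> R.
  by have := oalg_op_linear w (-1) 0 (0 : R); rewrite !scaleN1r !addNr.
elim/freeg_lin_ind: x => [|a t x IHx]; first by rewrite /fgraft raddf0 flift0 op0.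
rewrite /fgraft fglift_linear !flift_linear -/(fgraft w x) IHx oalg_op_linear.
by rewrite fgliftU !fliftU deval_graft.
Qed.

Definition tree_lift (X : tree_operatedAlg Omega C) : R :=
  flift (repr (X : treemod Omega C)).

Lemma tree_liftE x : tree_lift (cls x) = flift x.
Proof.
apply/eqP; rewrite -subr_eq0 addrC -scaleN1r -flift_linear scaleN1r addrC.
exact/eqP/flift_multilin/repr_cls.
Qed.

Lemma tree_lift_treeclass t : tree_lift (treeclass t) = deval t.
Proof. by rewrite tree_liftE fliftU. Qed.

Lemma tree_lift_operated_hom : operated_hom tree_lift.
Proof.
split; [split; [|split]|].
- move=> a; elim/treemod_ind=> x; elim/treemod_ind=> y.
  by rewrite [_ *: _]tscaleE [_ + _]taddE !tree_liftE flift_linear.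
- have [_ [f1 _]] := f_hom.
  by rewrite [LHS]tree_lift_treeclass deval_bullet.
- elim/treemod_ind=> x; elim/treemod_ind=> y.
  by rewrite [_ * _]tmulE !tree_liftE flift_fmul.
- move=> w; apply/funext; elim/treemod_ind=> x.
  by rewrite /= LambdaE !tree_liftE flift_fgraft.
Qed.

Lemma tree_lift_embed : tree_lift \o @tree_embed k Omega C = f.
Proof. by apply/funext=> c; rewrite /= tree_lift_treeclass deval_bullet. Qed.

End Evaluation.

Theorem theorem3p6 (k : fieldType) (hk : [pchar k]%R =i pred0)
    (Omega : Type) (hOmega : inhabited Omega) (C : comPzAlg k) :
  @is_free_operatedAlg k Omega C
    (@tree_operatedAlg k Omega C) (@tree_embed k Omega C).
Proof.
split=> [|R f f_hom]; first exact: tree_embed_alg_hom.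
exists (tree_lift f); split.
  by split; [exact: tree_lift_operated_hom | exact: tree_lift_embed].
move=> g [g_hom gf]; apply: operated_hom_ext => //; first exact: tree_lift_operated_hom.
by rewrite gf tree_lift_embed.
Qed.
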